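(* Let $p$ be a prime with $p \equiv 5 \pmod{6}$. Then for all integers $\alpha \geq 0$ and $n \geq 0$, and for every integer $i$ with $1 \leq i \leq p-1$, $$\mathrm{RD}^{(4,9)}\left(6p^{2\alpha+1}(pn+i) + 3p^{2\alpha+2} + 1\right) \equiv 0 \pmod{12}.$$
   Context: For a nonnegative integer $n$, $\mathrm{RD}^{(4,9)}(n)$ denotes the number of partitions of $n$ into parts that are simultaneously 4-regular and 9-distinct, i.e., partitions of $n$ in which no part is divisible by $4$ and each distinct part appears at least once and at most $8$ times. Equivalently, writing $f_k = \prod_{m\ge1}(1-q^{km})$, $\sum_{n\ge0}\mathrm{RD}^{(4,9)}(n)q^n = \frac{f_9 f_4}{f_1 f_{36}}$. *)

(* Defs.v *)
From mathcomp Require Import all_boot.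

Set Implicit Arguments.
Unset Strict Implicit.
Unset Printing Implicit Defensive.

(* A partition of n is its list of parts, in nonincreasing order. *)
Definition is_partition (n : nat) (s : seq nat) : bool :=
  [&& sorted geq s, all (fun k => 0 < k) s & sumn s == n].

Definition regular (l : nat) (s : seq nat) : bool :=
  all (fun k => ~~ (l %| k)) s.

(* t-distinct: every part is repeated at most t - 1 times. *)
Definition distinct (t : nat) (s : seq nat) : bool :=
  all (fun k => count_mem k s < t) s.

(* A partition of n has at most n parts, each at most n, so its list of parts
   lives in the finite type n.-bseq 'I_n.+1; see is_partition_bseq. *)
Definition RD (l t n : nat) : nat :=
  #|[set b : n.-bseq 'I_n.+1 |
      let s := [seq val k | k <- b] in
      [&& is_partition n s, regular l s & distinct t s]]|.

Lemma is_partition_bseq (n : nat) (s : seq nat) :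
  is_partition n s -> exists b : n.-bseq 'I_n.+1, [seq val k | k <- b] = s.
Proof.
case/and3P=> _ s_gt0 /eqP s_n.
have size_s : size s <= n.
  rewrite -s_n; elim: s s_gt0 {s_n} => //= x s IHs /andP[x_gt0 /IHs s_le].
  by rewrite -add1n leq_add.
have s_le k : k \in s -> k <= n.
  by move=> ks; rewrite -s_n (perm_sumn (perm_to_rem ks)) leq_addr.
have size_m : size [seq inord k : 'I_n.+1 | k <- s] <= n by rewrite size_map.
exists (Bseq size_m); rewrite /= -map_comp -[RHS]map_id.
by apply/eq_in_map => k ks; rewrite /= inordK // ltnS s_le.
Qed.

(* Main.v *)
Require Import Defs.
From mathcomp Require Import all_boot.
From Stdlib Require Import Setoid Morphisms.
From mathcomp Require Import all_order all_algebra.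
From mathcomp Require Import finfield zify ring.

(**
Write phi = phi(-q) = sum over all integers k of (-1)^k q^(k^2), and
psi = psi(q) = sum over k >= 0 of q^(k(k+1)/2). Gauss's identities
phi = f_1^2 / f_2 and psi = f_2^2 / f_1 (obtained here from Shanks's finite
forms) reduce everything to these theta series. The argument of RD is 3m+1 with
m = p^(2 alpha+1) c and c prime to p.

Modulo 4, f_4 / f_1 = psi(q) phi(-q^2), whose terms of exponent 1 mod 3 are
q psi(q^9) phi(-q^18) = q f_36 / f_9. Hence RD(3m+1) = 0 mod 4 for all m > 0.

Modulo 3, f_4 f_9 / (f_1 f_36) = (f_1 / f_4)^8 =: G, so that
G psi(q^2)^4 = phi^4, that is G s = phi(-q) phi(-q^3) with
s = psi(q^2) psi(q^6). Counting Eisenstein integers of given norm, on which a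
unit of order 3 acts freely, yields phi(-q) phi(-q^3) = 1 + q s.
Then G s^3 = s^2 + q s^3 where s^3 = s(q^3), and selecting exponents 1 mod 3
turns this into: the sum of RD(3m+1) q^m is 1 + q s. Its coefficient at m > 0
counts certain solutions of 4m = x^2 + 3y^2; there are none, since -3 is not a
square mod p and p divides 4m to an odd power.
*)

Set Implicit Arguments.
Unset Strict Implicit.
Unset Printing Implicit Defensive.

Import Order.TTheory GRing.Theory Num.Theory.
Local Open Scope ring_scope.

(** * Gauss's identities for finite sums *)

Section Gauss.
Variables (R : comNzRingType) (q : R).

(** Every exponent [s * n.+1] in the sum on the right exceeds [n], so modulo q^(n+1) only the first
    product survives and the identity becomes Gauss's. *)
Lemma shanks_square n :
  (\prod_(1 <= k < n.+1) (1 + q ^+ k)) *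
    (1 + 2 * \sum_(1 <= k < n.+1) (-1) ^+ k * q ^+ (k * k)) =
  \prod_(1 <= k < n.+1) (1 - q ^+ k) +
  2 * \sum_(1 <= s < n.+1) (-1) ^+ s * q ^+ (s * n.+1) *
    ((\prod_(1 <= k < s) (1 + q ^+ k)) * \prod_(s.+1 <= k < n.+1) (1 - q ^+ k)).
Proof.
elim: n => [|n IHn]; first by rewrite !big_geq //; ring.
(* [C] is the telescoping certificate: the term [s] for [n.+1] minus [1 + q ^+ n.+1] times the term
   [s] for [n] equals [C s.+1 - C s]. *)
pose C s := (-1) ^+ s * q ^+ (s * n.+1) *
  ((\prod_(1 <= k < s) (1 + q ^+ k)) * \prod_(s <= k < n.+1) (1 - q ^+ k)).
have tele : \sum_(1 <= s < n.+1) ((-1) ^+ s * q ^+ (s * n.+2) *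
    ((\prod_(1 <= k < s) (1 + q ^+ k)) * \prod_(s.+1 <= k < n.+2) (1 - q ^+ k)))
  = (1 + q ^+ n.+1) * \sum_(1 <= s < n.+1) ((-1) ^+ s * q ^+ (s * n.+1) *
    ((\prod_(1 <= k < s) (1 + q ^+ k)) * \prod_(s.+1 <= k < n.+1) (1 - q ^+ k)))
    + (C n.+1 - C 1%N).
  rewrite -(telescope_sumr C) // big_distrr -big_split /=.
  apply: eq_big_nat => s /andP[s_gt0 s_lt].
  rewrite /C (big_nat_recr n.+1) /=; last by lia.
  rewrite (big_nat_recr s) //= (big_ltn s_lt).
  rewrite (_ : s * n.+2 = s * n.+1 + s)%N; last by lia.
  rewrite mulSn !exprD [(-1) ^+ s.+1]exprS.
  ring.
have -> : \prod_(1 <= k < n.+2) (1 + q ^+ k)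
  = \prod_(1 <= k < n.+1) (1 + q ^+ k) * (1 + q ^+ n.+1).
  by rewrite big_nat_recr.
rewrite (big_nat_recr n.+1 _ (fun k => (-1) ^+ k * q ^+ (k * k))) //=.
rewrite [X in _ = _ + _ * X](big_nat_recr n.+1) //= tele.
rewrite [X in _ = X + _](big_nat_recr n.+1) //=.
rewrite [X in _ + _ * (_ + _ * (_ * X))]big_geq // /C.
rewrite [\prod_(n.+1 <= k < n.+1) _]big_geq // [\prod_(1 <= k < 1) _]big_geq //.
rewrite (_ : n.+1 * n.+2 = n.+1 * n.+1 + n.+1)%N; last by lia.
rewrite mul1n expr1 exprD.
set x := q ^+ n.+1; set e := (-1) ^+ n.+1; set y := q ^+ (n.+1 * n.+1).
move: IHn; set A := \prod_(_ <= _ < _) _; set B := \prod_(_ <= _ < _) _.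
set S := \sum_(_ <= _ < _) _; set T := \sum_(_ <= _ < _) _ => IHn.
have -> : A * (1 + x) * (1 + 2 * (S + e * y)) =
  (1 + x) * (A * (1 + 2 * S)) + 2 * (A * (1 + x) * e * y) by ring.
rewrite IHn; ring.
Qed.

(** The same telescoping works, with multiplier [1 - q ^+ n.*2.+1]. On the right, the term [s = 0]
    is the product of the even factors; all others have exponent at least [n.*2.+1]. *)
Lemma shanks_triangle n :
  (\prod_(0 <= k < n) (1 - q ^+ k.*2.+1)) * \sum_(0 <= s < n.*2) q ^+ 'C(s.+1, 2) =
  \sum_(0 <= s < n) q ^+ (s * n.*2.+1) *
    ((\prod_(0 <= k < s) (1 - q ^+ k.*2.+1)) *
     \prod_(s.+1 <= k < n.+1) (1 - q ^+ k.*2)).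
Proof.
elim: n => [|n IHn]; first by rewrite !big_geq // mulr0.
pose C s := q ^+ (s * n.*2.+1) *
  ((\prod_(0 <= k < s) (1 - q ^+ k.*2.+1)) * \prod_(s <= k < n.+1) (1 - q ^+ k.*2)).
have tele : \sum_(0 <= s < n.+1) (q ^+ (s * n.+1.*2.+1) *
    ((\prod_(0 <= k < s) (1 - q ^+ k.*2.+1)) *
     \prod_(s.+1 <= k < n.+2) (1 - q ^+ k.*2)))
  = (1 - q ^+ n.*2.+1) * \sum_(0 <= s < n.+1) (q ^+ (s * n.*2.+1) *
    ((\prod_(0 <= k < s) (1 - q ^+ k.*2.+1)) *
     \prod_(s.+1 <= k < n.+1) (1 - q ^+ k.*2)))
    + (C n.+1 - C 0%N).
  rewrite -(telescope_sumr C) // big_distrr -big_split /=.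
  apply: eq_big_nat => s /andP[_ s_lt].
  rewrite /C (big_nat_recr n.+1) /=; last by lia.
  rewrite (big_nat_recr s) //= (big_ltn s_lt).
  rewrite (_ : s * n.+1.*2.+1 = s * n.*2.+1 + s.*2)%N; last by lia.
  rewrite mulSn (_ : n.+1.*2 = n.*2.+1 + 1)%N; last by lia.
  rewrite !exprD expr1 [q ^+ s.*2.+1]exprS.
  ring.
(* The product in [C 0] contains the factor [k = 0], that is [1 - q ^+ 0]. *)
have C0 : C 0%N = 0 by rewrite /C (big_ltn (ltn0Sn n)) /= expr0; ring.
rewrite tele C0 [X in _ = _ * X + _]big_nat_recr //= -IHn.
rewrite /C ![\prod_(n.+1 <= _ < n.+1) _]big_geq // doubleS !big_nat_recr //=.
have bin2E s : 'C(s.+1, 2) = (s.+1 * s)./2 by rewrite bin2.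
have -> : 'C(n.*2.+1, 2) = (n * n.*2.+1)%N.
  by rewrite bin2E -doubleMr doubleK mulnC.
have -> : 'C(n.*2.+2, 2) = (n.+1 * n.*2.+1)%N.
  by rewrite bin2E -doubleS -doubleMl doubleK.
ring.
Qed.

End Gauss.

(** * Polynomials as truncated power series *)

Section Truncation.
Variable R : comNzRingType.
Implicit Types P Q A B : {poly R}.

Definition eqX (N : nat) P Q := forall i, (i < N)%N -> P`_i = Q`_i.

Lemma eqX_refl N P : eqX N P P. Proof. by []. Qed.

Lemma eqX_sym N P Q : eqX N P Q -> eqX N Q P.
Proof. by move=> PQ i /PQ. Qed.

Lemma eqX_trans N P Q A : eqX N P Q -> eqX N Q A -> eqX N P A.
Proof. by move=> PQ QA i iN; rewrite PQ ?QA. Qed.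

Lemma eqX_leq M N P Q : (M <= N)%N -> eqX N P Q -> eqX M P Q.
Proof. by move=> MN PQ i /leq_trans-/(_ _ MN)/PQ. Qed.

Lemma eqXD N P Q A B : eqX N P Q -> eqX N A B -> eqX N (P + A) (Q + B).
Proof. by move=> PQ AB i iN; rewrite !coefD PQ ?AB. Qed.

Lemma eqXM N P Q A B : eqX N P Q -> eqX N A B -> eqX N (P * A) (Q * B).
Proof.
move=> PQ AB i iN; rewrite !coefM; apply: eq_bigr => j _.
by rewrite PQ ?AB //; apply: leq_ltn_trans iN; rewrite ?leq_subr // -ltnS.
Qed.

Lemma eqX_exp N P Q k : eqX N P Q -> eqX N (P ^+ k) (Q ^+ k).
Proof. by move=> PQ; elim: k => // k IHk; rewrite !exprS; apply: eqXM. Qed.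

Lemma eqX_sum N I (r : seq I) (p : pred I) (F G : I -> {poly R}) :
    (forall i, p i -> eqX N (F i) (G i)) ->
  eqX N (\sum_(i <- r | p i) F i) (\sum_(i <- r | p i) G i).
Proof.
by move=> FG; elim/big_ind2: _ => // *; apply: eqXD.
Qed.

Lemma eqX_prod N I (r : seq I) (p : pred I) (F G : I -> {poly R}) :
    (forall i, p i -> eqX N (F i) (G i)) ->
  eqX N (\prod_(i <- r | p i) F i) (\prod_(i <- r | p i) G i).
Proof.
by move=> FG; elim/big_ind2: _ => // *; apply: eqXM.
Qed.

Lemma eqX_mulXn N k P : (N <= k)%N -> eqX N ('X^k * P) 0.
Proof.
by move=> Nk i iN; rewrite coefXnM coef0 (leq_trans iN Nk).
Qed.

Lemma eqX_Xn N k : (N <= k)%N -> eqX N 'X^k 0.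
Proof. by move/eqX_mulXn => /(_ 1); rewrite mulr1. Qed.

(** [A] is invertible as a power series. By strong induction, the convolution for [A * (P - Q)]
    reduces to the coefficient [i] of [P - Q]. *)
Lemma eqX_cancel N A P Q : A`_0 = 1 -> eqX N (A * P) (A * Q) -> eqX N P Q.
Proof.
move=> A0 APQ i iN; apply/eqP; rewrite -subr_eq0 -coefB; apply/eqP.
elim/ltn_ind: i iN => i IHi iN.
have : (A * (P - Q))`_i = 0 by rewrite mulrBr coefB APQ ?subrr.
rewrite coefM big_ord_recl A0 mul1r subn0 big1 ?addr0 // => j _.
have ? := ltn_ord j; rewrite IHi ?mulr0 //=; rewrite /bump; lia.
Qed.

Lemma eqX_comp N k P Q : (0 < k)%N ->
  eqX N P Q -> eqX N (P \Po 'X^k) (Q \Po 'X^k).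
Proof.
move=> k_gt0 PQ i iN; rewrite !coef_comp_poly_Xn //; case: ifP => // _.
by apply: PQ; apply: leq_ltn_trans iN; apply: leq_div.
Qed.

Lemma comp_XnXn P k l : (P \Po 'X^k) \Po 'X^l = P \Po 'X^(k * l).
Proof. by rewrite -comp_polyA comp_Xn_poly -exprM mulnC. Qed.

Lemma coef0_comp_Xn k P : (0 < k)%N -> (P \Po 'X^k)`_0 = P`_0.
Proof. by move=> ?; rewrite coef_comp_poly_Xn // dvdn0 div0n. Qed.

Lemma coef0_exp P k : P`_0 = 1 -> (P ^+ k)`_0 = 1.
Proof. by move=> P0; rewrite -horner_coef0 hornerE horner_coef0 P0 expr1n. Qed.

(** The size bound loses nothing: [3 * i + 1] is beyond the size of [P] whenever [i] is. *)
Definition trisect P := \poly_(i < size P) P`_(3 * i + 1).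

Lemma coef_trisect P i : (trisect P)`_i = P`_(3 * i + 1).
Proof.
rewrite coef_poly; case: ltnP => // Pi; rewrite nth_default //.
by apply: leq_trans Pi _; lia.
Qed.

Lemma eqX_trisect N P Q : eqX (3 * N) P Q -> eqX N (trisect P) (trisect Q).
Proof. by move=> PQ i iN; rewrite !coef_trisect PQ //; lia. Qed.

Lemma trisectD P Q : trisect (P + Q) = trisect P + trisect Q.
Proof. by apply/polyP=> i; rewrite coefD !coef_trisect coefD. Qed.

Lemma trisect_X3 P : trisect ('X^3 * P) = 'X * trisect P.
Proof.
apply/polyP=> i; rewrite coef_trisect coefXnM mulrC coefMX.
by case: i => [|i] //=; rewrite coef_trisect ifF; [congr _`_ _|]; lia.
Qed.

(** Series in X^3 act as scalars: a factor X of [A] enters as X^3 and leaves [trisect] as X. *)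
Lemma trisectM A P : trisect ((A \Po 'X^3) * P) = A * trisect P.
Proof.
elim/poly_ind: A P => [|A c IHA] P.
  by rewrite comp_poly0 !mul0r; apply/polyP => i; rewrite coef_trisect !coef0.
rewrite comp_poly_MXaddC mulrDl -mulrA trisectD IHA trisect_X3 mulrDl mulrA.
congr (_ + _); apply/polyP => i.
by rewrite coef_trisect !coefCM coef_trisect.
Qed.

Lemma trisect_comp A : trisect (A \Po 'X^3) = 0.
Proof.
rewrite -[_ \Po _]mulr1 trisectM [trisect 1](_ : _ = 0) ?mulr0 //.
by apply/polyP => i; rewrite coef_trisect coef1 coef0 addn1.
Qed.

Lemma trisectX A : trisect ((A \Po 'X^3) * 'X) = A.
Proof.
rewrite trisectM [trisect 'X](_ : _ = 1) ?mulr1 //.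
by apply/polyP => i; rewrite coef_trisect coefX coef1; case: i => //= i; congr (_%:R); lia.
Qed.

Lemma trisectX2 A : trisect ((A \Po 'X^3) * 'X^2) = 0.
Proof.
rewrite trisectM [trisect 'X^2](_ : _ = 0) ?mulr0 //.
apply/polyP => i; rewrite coef_trisect coefXn coef0 (_ : _ == _ = false) //; lia.
Qed.

End Truncation.

#[local] Instance eqX_equivalence (R : comNzRingType) N : Equivalence (@eqX R N).
Proof. split; [exact: eqX_refl|exact: eqX_sym|exact: eqX_trans]. Qed.

#[local] Instance eqXD_proper (R : comNzRingType) N :
  Proper (@eqX R N ==> @eqX R N ==> @eqX R N) +%R.
Proof. by move=> P Q PQ A B AB; apply: eqXD. Qed.

#[local] Instance eqXM_proper (R : comNzRingType) N :
  Proper (@eqX R N ==> @eqX R N ==> @eqX R N) *%R.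
Proof. by move=> P Q PQ A B AB; apply: eqXM. Qed.

#[local] Instance eqX_exp_proper (R : comNzRingType) N :
  Proper (@eqX R N ==> eq ==> @eqX R N) (@GRing.exp {poly R}).
Proof. by move=> P Q PQ k _ <-; apply: eqX_exp. Qed.

Lemma poly_natr_eq0 (R : comNzRingType) k :
  k%:R = 0 :> R -> k%:R = 0 :> {poly R}.
Proof. by move=> k0; rewrite -polyC1 -polyCMn k0. Qed.

(** * Theta series *)

Section Series.
Variable R : comNzRingType.

(* The product f_k, and phi(-q) and psi(q), all truncated at index K. *)
Definition euler K k : {poly R} := \prod_(1 <= m < K) (1 - 'X^(k * m)).
Definition theta K : {poly R} :=
  1 + 2 * \sum_(1 <= k < K) (-1) ^+ k * 'X^(k * k).
Definition psi K : {poly R} := \sum_(0 <= s < K) 'X^('C(s.+1, 2)).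

Lemma leq_bin2S s : (s <= 'C(s.+1, 2))%N.
Proof. by rewrite binS bin1 leq_addl. Qed.

Lemma bin2S_double s : ('C(s.+1, 2) * 2 = s.+1 * s)%N.
Proof. by rewrite mulnC (mul_bin_left s.+1 1) bin1 subn1 mulnC. Qed.

Lemma euler_comp K k l : euler K k \Po 'X^l = euler K (k * l).
Proof.
rewrite /euler rmorph_prod; apply: eq_bigr => m _.
by rewrite rmorphB rmorph1 /= comp_Xn_poly -exprM mulnAC (mulnC l).
Qed.

Lemma eqX_sum_geq N K M (F : nat -> {poly R}) :
    (forall k, (N <= k)%N -> eqX N (F k) 0) -> (N <= K)%N -> (K <= M)%N ->
  eqX N (\sum_(K <= k < M) F k) 0.
Proof.
move=> F0 NK KM; rewrite big_nat_cond.
rewrite (@eqX_sum _ _ _ _ _ F (fun=> 0)) ?big1 //.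
by move=> k /andP[/andP[Kk _] _]; apply: F0; apply: leq_trans Kk.
Qed.

Lemma eqX_prod_geq N K M (F : nat -> {poly R}) :
    (forall k, (N <= k)%N -> eqX N (F k) 1) -> (N <= K)%N -> (K <= M)%N ->
  eqX N (\prod_(K <= k < M) F k) 1.
Proof.
move=> F1 NK KM; rewrite big_nat_cond.
rewrite (@eqX_prod _ _ _ _ _ F (fun=> 1)) ?big1 //.
by move=> k /andP[/andP[Kk _] _]; apply: F1; apply: leq_trans Kk.
Qed.

Lemma eqX_1subXn N k : (N <= k)%N -> eqX N (1 - 'X^k) (1 : {poly R}).
Proof. by move=> Nk i iN; rewrite coefB (eqX_Xn _ Nk) // coef0 subr0. Qed.

Lemma euler_stable N K M k : (0 < k)%N -> (0 < N)%N -> (N <= K)%N -> (K <= M)%N ->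
  eqX N (euler M k) (euler K k).
Proof.
move=> k_gt0 N_gt0 NK KM; rewrite /euler (@big_cat_nat _ _ _ K) //=; last by lia.
rewrite (eqX_prod_geq _ NK KM) ?mulr1 // => m Nm.
by apply: eqX_1subXn; apply: leq_trans Nm (leq_pmull _ _).
Qed.

Lemma psi_stable N K M : (N <= K)%N -> (K <= M)%N -> eqX N (psi M) (psi K).
Proof.
move=> NK KM; rewrite /psi (@big_cat_nat _ _ _ K) //=.
rewrite (eqX_sum_geq _ NK KM) ?addr0 // => s Ns.
by apply: eqX_Xn; apply: leq_trans Ns (leq_bin2S _).
Qed.

Lemma theta_stable N K M : (0 < N)%N -> (N <= K)%N -> (K <= M)%N ->
  eqX N (theta M) (theta K).
Proof.
move=> N_gt0 NK KM; rewrite /theta (@big_cat_nat _ _ _ K) //=; last by lia.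
rewrite (eqX_sum_geq _ NK KM) ?addr0 // => s Ns.
rewrite mulrC; apply: eqX_mulXn; nia.
Qed.

Lemma coef0_euler K k : (0 < k)%N -> (euler K k)`_0 = 1.
Proof.
move=> k_gt0; rewrite -horner_coef0 horner_prod big_nat big1 // => m /andP[m_gt0 _].
rewrite !hornerE expr0n muln_eq0; case: eqP; [|case: eqP]; rewrite ?subr0 //; lia.
Qed.

Lemma coef0_psi K : (0 < K)%N -> (psi K)`_0 = 1.
Proof.
case: K => // K _; rewrite -horner_coef0 horner_sum big_nat_recl // big1 ?addr0.
  by rewrite hornerXn bin_small.
by move=> m _; rewrite hornerXn expr0n gtn_eqF // bin_gt0.
Qed.

Lemma coef0_theta K : (theta K)`_0 = 1.
Proof.
rewrite -horner_coef0 !hornerE horner_sum big_nat big1 ?mulr0 ?addr0 //.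
by move=> m /andP[m0 _]; rewrite !hornerE expr0n muln_eq0 gtn_eqF // mulr0.
Qed.

(** Shanks's identity is multiplied by f_1, which turns the product of the [1 + 'X ^+ k] into f_2;
    its remainder has exponents at least [K]. *)
Lemma gauss_square N K : (N <= K)%N ->
  eqX N (theta K * euler K 2) (euler K 1 ^+ 2).
Proof.
case: K => [|n] NK; first by move: NK; rewrite leqn0 => /eqP-> i.
have E1 : \prod_(1 <= k < n.+1) (1 - 'X ^+ k) = euler n.+1 1.
  by apply: eq_bigr => k _; rewrite mul1n.
have E2 : \prod_(1 <= k < n.+1) (1 + 'X ^+ k) * euler n.+1 1 = euler n.+1 2.
  rewrite /euler -big_split; apply: eq_bigr => k _ /=.
  by rewrite mul1n mulnC exprM; ring.
have := shanks_square ('X : {poly R}) n; rewrite E1 -/(theta _) -{}E2.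
set S := \sum_(1 <= s < n.+1) _; set D := \prod_(1 <= k < n.+1) _ => eqS.
have S0 : eqX N S 0.
  rewrite /S big_nat_cond.
  rewrite (@eqX_sum _ _ _ _ _ _ (fun=> 0)) ?big1 // => s /andP[/andP[s_gt0 _] _].
  by rewrite mulrAC mulrC; apply: eqX_mulXn; nia.
rewrite mulrA [theta _ * _]mulrC eqS S0 mulr0 addr0.
by rewrite expr2.
Qed.

Lemma prod_parity n (F : nat -> {poly R}) :
  \prod_(1 <= m < n.*2.+1) F m =
  \prod_(0 <= k < n) F k.*2.+1 * \prod_(1 <= k < n.+1) F k.*2.
Proof.
elim: n => [|n IHn]; first by rewrite !big_geq ?mulr1.
rewrite doubleS 2?big_nat_recr //= IHn.
by rewrite [in RHS]big_nat_recr //= [X in _ = _ * X]big_nat_recr //=; ring.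
Qed.

(** Shanks's identity involves 2K terms of psi and the odd factors below 2K, so the truncations are
    enlarged first. One f_2 comes from the even factors of f_1, the other from the term [s = 0]. *)
Lemma gauss_triangle N K : (0 < N)%N -> (N <= K)%N ->
  eqX N (psi K * euler K 1) (euler K 2 ^+ 2).
Proof.
move=> N_gt0 NK.
have K2 : (K <= K.*2.+1)%N by lia.
rewrite -(@psi_stable N K K.*2) //; last by lia.
rewrite -(@euler_stable N K K.*2.+1) //.
rewrite -(@euler_stable N K K.+1 2) //.
have -> : euler K.*2.+1 1 =
    \prod_(0 <= k < K) (1 - 'X ^+ k.*2.+1) * \prod_(1 <= k < K.+1) (1 - 'X ^+ k.*2).
  rewrite -(prod_parity K (fun m => 1 - 'X^m)).
  by apply: eq_bigr => k _; rewrite mul1n.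
have -> : \prod_(1 <= k < K.+1) (1 - 'X ^+ k.*2) = euler K.+1 2.
  by apply: eq_bigr => k _; rewrite mul2n.
rewrite mulrA [psi _ * _]mulrC shanks_triangle.
rewrite big_ltn ?(leq_trans N_gt0) // mul0n expr0 mul1r big_geq // mul1r.
have -> : \prod_(1 <= k < K.+1) (1 - 'X ^+ k.*2) = euler K.+1 2.
  by apply: eq_bigr => k _; rewrite mul2n.
set S := \sum_(1 <= s < K) _.
have S0 : eqX N S 0.
  rewrite /S big_nat_cond.
  rewrite (@eqX_sum _ _ _ _ _ _ (fun=> 0)) ?big1 // => s /andP[/andP[s_gt0 _] _].
  by apply: eqX_mulXn; nia.
by rewrite S0 addr0 expr2.
Qed.
End Series.

(** * Norms of Eisenstein integers *)

(** All orbits of [f] have exactly three elements; the orbit of the head is removed and induction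
    applies to the rest. *)
Lemma dvd3_size_free (T : eqType) (f : T -> T) (s : seq T) : uniq s ->
    {in s, forall x, [/\ f x \in s, f x != x & f (f (f x)) = x]} ->
  (3 %| size s)%N.
Proof.
elim: {s}(size s) {-2}s (leqnn (size s)) => [|n IHn] [|x s] //= le_s uniq_s fP.
set t := x :: s in uniq_s fP.
have xt : x \in t := mem_head x s.
have [fxt fx_neq fffx] := fP x xt; have [ffxt ffx_neq _] := fP _ fxt.
have ffx_neq' : f (f x) != x by apply: contraNneq fx_neq => {1}<-; rewrite fffx.
pose orb := [:: x; f x; f (f x)].
have uniq_orb : uniq orb.
  by rewrite /= !inE negb_or !(eq_sym x) fx_neq ffx_neq' (eq_sym (f x)) ffx_neq.
have perm_t : perm_eq t (orb ++ [seq y <- t | y \notin orb]).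
  apply: uniq_perm => //.
    rewrite cat_uniq uniq_orb filter_uniq // andbT -all_predC.
    by apply/allP => y; rewrite mem_filter => /andP[].
  move=> y; rewrite mem_cat mem_filter.
  case: (boolP (y \in orb)) => //= y_orb.
  by move: y_orb; rewrite !inE => /or3P[] /eqP->.
have sizeE : size t = (3 + size [seq y <- t | y \notin orb])%N.
  by rewrite (perm_size perm_t) size_cat.
rewrite -[(size s).+1]/(size t) sizeE dvdn_addr //.
apply: IHn; first by move: sizeE; rewrite [size t]/=; lia.
  exact: filter_uniq.
move=> y; rewrite mem_filter => /andP[y_orb yt].
(* The rest is stable under [f]: if [f y] lies in the orbit, so does [y = f (f (f y))]. *)
have [fyt fy_neq fffy] := fP y yt; split=> //.
rewrite mem_filter fyt andbT; apply: contra y_orb.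
by rewrite !inE -{4 5 6}fffy => /or3P[] /eqP->; rewrite ?fffx eqxx ?orbT.
Qed.

Definition int_ball K : seq int :=
  [seq k%:Z | k <- iota 0 K] ++ [seq - k%:Z | k <- iota 1 K.-1].

Lemma mem_int_ball K a : (a \in int_ball K) = (`|a| < K)%N.
Proof.
rewrite mem_cat; apply/orP/idP.
  by case=> /mapP[k]; rewrite mem_iota => kK ->; lia.
move=> aK; case: (lerP 0 a) => a0.
  by left; apply/mapP; exists `|a|%N; rewrite ?mem_iota; lia.
by right; apply/mapP; exists `|a|%N; rewrite ?mem_iota; lia.
Qed.

Lemma uniq_int_ball K : uniq (int_ball K).
Proof.
rewrite cat_uniq !map_inj_uniq ?iota_uniq; try by move=> x y; lia.
rewrite andbT /=; apply/hasPn => _ /mapP[k + ->]; rewrite mem_iota => kK.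
by apply/negP => /mapP[j _]; lia.
Qed.

(** Elements a + b sqrt(-3) of norm [m] in a finite box; none is missed once [m < K]. *)
Definition norm_fiber K m : seq (int * int) :=
  [seq u <- [seq (a, b) | a <- int_ball K, b <- int_ball K] |
    (`|u.1| * `|u.1| + 3 * (`|u.2| * `|u.2|) == m)%N].

Lemma sqrz_absz (a : int) : (`|a| * `|a|)%N%:Z = a * a.
Proof. by rewrite -abszM gez0_abs // -expr2 sqr_ge0. Qed.

Lemma mem_norm_fiber K m a b : (m < K)%N ->
  ((a, b) \in norm_fiber K m) = (a * a + 3 * (b * b) == m%:Z).
Proof.
move=> mK; rewrite mem_filter -!sqrz_absz -[3]/(3%N%:Z) -PoszM -PoszD eqz_nat /=.
apply: andb_idr => /eqP abm; apply/allpairsP; exists (a, b).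
by split=> //=; rewrite mem_int_ball; nia.
Qed.

(* Rotation by a third of a turn: a + b sqrt(-3), with a = b + 2 c, is
   multiplied by (-1 + sqrt(-3)) / 2. *)
Definition rotate (u : int * int) : int * int :=
  let c := ((u.1 - u.2) %/ 2)%Z in (- (u.2 *+ 2) - c, c).

(** Norm 4n forces a and b to have equal parity, so [rotate] is an exact multiplication by a cube
    root of unity. It fixes only 0, which [0 < n] excludes. *)
Lemma dvd3_norm_fiber K n : (0 < n)%N -> (4 * n < K)%N ->
  (3 %| size (norm_fiber K (4 * n)))%N.
Proof.
move=> n_gt0 nK; apply: (@dvd3_size_free _ rotate).
  by apply/filter_uniq/allpairs_uniq; rewrite ?uniq_int_ball // => -[? ?] [? ?].
move=> [a b]; rewrite mem_norm_fiber // => /eqP abn.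
have [c aE] : exists c, a = b + c *+ 2.
  exists ((a - b) %/ 2)%Z.
  (* With opposite parities, a^2 + 3b^2 would be odd. *)
  have a2 := divz_eq a 2; have b2 := divz_eq b 2.
  have ra : (a %% 2)%Z = 0 \/ (a %% 2)%Z = 1 by lia.
  have rb : (b %% 2)%Z = 0 \/ (b %% 2)%Z = 1 by lia.
  suff : (a %% 2)%Z = (b %% 2)%Z by lia.
  move: a2 b2 ra rb; set x := (a %/ 2)%Z; set y := (b %/ 2)%Z.
  set r := (a %% 2)%Z; set s := (b %% 2)%Z => a2 b2 [] r0 [] s0; subst r s;
    rewrite r0 s0 in a2 b2 *; try done.
  - exfalso; move: abn; rewrite a2 b2; nia.
  - exfalso; move: abn; rewrite a2 b2; nia.
have rotE x y : rotate (x + y *+ 2, x) = (- (x *+ 2) - y, y).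
  by rewrite /rotate /= (_ : (_ %/ 2)%Z = y) //; lia.
rewrite aE rotE; split.
- by rewrite mem_norm_fiber // -abn aE; apply/eqP; ring.
- by apply/eqP => -[h1 h2]; move: abn; rewrite aE; nia.
- rewrite (_ : - (b *+ 2) - c = c + (- b - c) *+ 2); last by ring.
  rewrite rotE (_ : - (c *+ 2) - (- b - c) = (- b - c) + b *+ 2); last by ring.
  by rewrite rotE; congr (_, _); ring.
Qed.

(** * The product phi(-q) phi(-q^3) modulo 3 *)

Section Eisenstein.
Variable R : comNzRingType.

(** This is the series without signs, phi(q); [theta] is obtained from it by [theta_phi]. *)
Definition phi K : {poly R} := 1 + 2 * \sum_(1 <= k < K) 'X^(k * k).

Lemma phi_int_ball K : (0 < K)%N ->
  phi K = \sum_(a <- int_ball K) 'X^(`|a| * `|a|).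
Proof.
move=> K_gt0; rewrite big_cat !big_map /=.
under [X in _ = _ + X]eq_bigr do rewrite abszN /=.
under [X in _ = X + _]eq_bigr do rewrite /=.
have -> : iota 0 K = index_iota 0 K by rewrite /index_iota subn0.
by rewrite big_ltn // -subn1 -/(index_iota 1 K) /phi; ring.
Qed.

Lemma coef_phi_phi3 K m : (0 < K)%N ->
  (phi K * (phi K \Po 'X^3))`_m = (size (norm_fiber K m))%:R.
Proof.
move=> K_gt0; rewrite phi_int_ball // rmorph_sum big_distrlr coef_sum /=.
rewrite /norm_fiber size_filter -sum1_count natr_sum [in RHS]big_mkcond big_allpairs /=.
apply: eq_bigr => a _; rewrite coef_sum; apply: eq_bigr => b _.
by rewrite comp_Xn_poly -exprM -exprD coefXn eq_sym; case: ifP.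
Qed.

(** Even indices contribute (2j)^2 = 4j^2, odd ones (2j+1)^2 = 8 'C(j+1, 2) + 1. *)
Lemma phi_bisect M : (0 < M)%N ->
  phi M.*2 = (phi M \Po 'X^4) + 2 * ((psi R M \Po 'X^8) * 'X).
Proof.
have phiE K : (0 < K)%N -> phi K = 2 * \sum_(0 <= k < K) 'X^(k * k) - 1.
  by move=> K0; rewrite /phi (big_ltn K0) expr0; ring.
move=> M_gt0; rewrite !phiE ?double_gt0 //.
rewrite rmorphB rmorphM rmorph1 (rmorph_nat (comp_poly 'X^4)) /=.
suff -> : \sum_(0 <= k < M.*2) 'X^(k * k) =
    ((\sum_(0 <= k < M) 'X^(k * k)) \Po 'X^4) + (psi R M \Po 'X^8) * 'X by ring.
elim: M {M_gt0} => [|M IHM].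
  by rewrite /psi !big_geq // !comp_poly0 mul0r addr0.
have cM := bin2S_double M.
rewrite doubleS /psi !big_nat_recr //= -/(psi _ _) IHM.
rewrite !comp_polyD !comp_Xn_poly -!exprM.
rewrite (_ : M.*2.+1 * M.*2.+1 = (8 * 'C(M.+1, 2)).+1)%N; last by nia.
rewrite (_ : M.*2 * M.*2 = 4 * (M * M))%N; last by nia.
by rewrite (exprS _ (8 * _)); ring.
Qed.

Hypothesis R3 : 3 = 0 :> R.

Lemma natr_dvd3 m : (3 %| m)%N -> m%:R = 0 :> R.
Proof. by case/dvdnP => k ->; rewrite natrM R3 mulr0. Qed.

(** By [phi_bisect], the terms of phi(q) phi(q^3) with exponent divisible by 4 are phi(q^4)
    phi(q^12) + 4 q^4 psi(q^8) psi(q^24), and 4 = 1. The coefficient at [n] is thus the number of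
    pairs of norm [4 * n], a multiple of 3. *)
Lemma coef_phi_psi M n : (0 < n)%N -> (2 * n < M)%N ->
  (phi M * (phi M \Po 'X^3) + 'X * ((psi R M \Po 'X^2) * (psi R M \Po 'X^6)))`_n
    = 0.
Proof.
move=> n_gt0 nM; set S := _ + _.
have M_gt0 : (0 < M)%N by lia.
have coef4 (P : {poly R}) k r : (k < 4)%N -> 
    ((P \Po 'X^4) * 'X^k)`_(4 * r) = if k == 0%N then P`_r else 0.
  move=> k4; rewrite coefMXn; case: eqP => [->|/eqP k0].
    by rewrite ltn0 subn0 coef_comp_poly_Xn // dvdn_mulr // mulKn.
  case: ltnP => // kr; rewrite coef_comp_poly_Xn // ifF //; lia.
have -> : S`_n = (phi M.*2 * (phi M.*2 \Po 'X^3))`_(4 * n).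
  rewrite phi_bisect // !(rmorphD, rmorphM) /= rmorph1 !comp_XnXn comp_polyX.
  transitivity (((phi M * (phi M \Po 'X^3) +
      4 * 'X * ((psi R M \Po 'X^2) * (psi R M \Po 'X^6))) \Po 'X^4) * 'X^0 +
   (2 * ((psi R M \Po 'X^2) * (phi M \Po 'X^3)) \Po 'X^4) * 'X^1 + 
   (2 * ((psi R M \Po 'X^6) * phi M) \Po 'X^4) * 'X^3)`_(4 * n).
    rewrite !coefD !coef4 //= !addr0 (_ : 4 = 1 + 3); last by ring.
    by rewrite poly_natr_eq0 // addr0 mul1r coefD.
  rewrite !(rmorphD, rmorphM) /= !rmorph1 !comp_XnXn comp_polyX.
  by congr (polyseq _)`_(4 * n); ring.
rewrite coef_phi_phi3 ?double_gt0 // natr_dvd3 // dvd3_norm_fiber //; lia.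
Qed.

Lemma coef_comp_NX (P : {poly R}) i : (P \Po - 'X)`_i = (-1) ^+ i * P`_i.
Proof.
elim/poly_ind: P i => [|P c IHP] i; first by rewrite comp_poly0 !coef0 mulr0.
rewrite comp_poly_MXaddC mulrN !coefD coefN !coefMX !coefC.
by case: i => [|i] /=; rewrite ?IHP ?exprS; ring.
Qed.

Lemma theta_phi K : theta R K = phi K \Po - 'X.
Proof.
rewrite /theta /phi rmorphD rmorphM rmorph_sum (rmorph_nat (comp_poly (- 'X))).
rewrite rmorph1 /=; congr (_ + _ * _); apply: eq_bigr => k _.
by rewrite comp_Xn_poly (exprNn 'X) -signr_odd -[in RHS]signr_odd oddM andbb.
Qed.

(* The substitution of -X turns phi into theta; Xs, being odd, changes sign. *)
Lemma theta_theta3 N K : (0 < N)%N -> (2 * N <= K)%N ->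
  eqX N (theta R K * (theta R K \Po 'X^3))
    (1 + 'X * ((psi R K \Po 'X^2) * (psi R K \Po 'X^6))).
Proof.
move=> N_gt0 NK.
pose s : {poly R} := (psi R K \Po 'X^2) * (psi R K \Po 'X^6).
have X2 : (- 'X) ^+ 2 = 'X^2 :> {poly R} by ring.
have X6 : (- 'X) ^+ 6 = 'X^6 :> {poly R} by ring.
have sE : s \Po - 'X = s.
  by rewrite /s rmorphM /= -!comp_polyA !comp_Xn_poly X2 X6.
have thE : theta R K * (theta R K \Po 'X^3) - 'X * s =
    (phi K * (phi K \Po 'X^3) + 'X * s) \Po - 'X.
  rewrite [RHS]comp_polyD (comp_polyM 'X) (comp_polyM (phi K)) sE comp_polyX.
  rewrite theta_phi -!comp_polyA.
  rewrite rmorphN /= comp_polyX !comp_Xn_poly.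
  have -> : (- 'X) ^+ 3 = - 'X^3 :> {poly R} by ring.
  ring.
suff : eqX N (theta R K * (theta R K \Po 'X^3) - 'X * s) 1.
  move=> eq1 i iN; rewrite coefD -(eq1 i iN) -/s !coefB; ring.
move=> i iN; rewrite thE coef_comp_NX.
case: i iN => [|i] iN; last by rewrite coef_phi_psi // ?mulr0 ?coef1 //; lia.
rewrite expr0 mul1r coef1 coefD coef0M coefXM addr0 coef0_comp_Xn //.
have -> : (phi K)`_0 = 1.
  rewrite -horner_coef0 !hornerE horner_sum big_nat big1 ?mulr0 ?addr0 //.
  by move=> m /andP[m0 _]; rewrite hornerXn expr0n muln_eq0 gtn_eqF.
by rewrite mulr1.
Qed.
End Eisenstein.

(** * Dissection modulo 3 *)

Section Dissection.
Variable R : comNzRingType.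

(** The number 'C(s+1, 2) is divisible by 3 for s = 3j and s = 3j+2, and equals 9 'C(j+1, 2) + 1 for
    s = 3j+1. *)
Lemma psi_dissect J :
  exists A : {poly R}, psi R (3 * J) = (A \Po 'X^3) + (psi R J \Po 'X^9) * 'X.
Proof.
elim: J => [|J [A IHJ]].
  by exists 0; rewrite /psi !big_geq // !comp_poly0 mul0r addr0.
exists (A + 'X^('C((3 * J).+1, 2) %/ 3) + 'X^('C((3 * J).+3, 2) %/ 3)).
have c0 := bin2S_double (3 * J); have c1 := bin2S_double (3 * J).+1.
have c2 := bin2S_double (3 * J).+2; have cJ := bin2S_double J.
rewrite mulnS add3n /psi !big_nat_recr //= -/(psi _ _) IHJ.
rewrite !comp_polyD !comp_Xn_poly -!exprM -/(psi _ _).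
rewrite (_ : 'C((3 * J).+2, 2) = (9 * 'C(J.+1, 2)).+1)%N; last by nia.
rewrite !(mulnC 3%N (_ %/ _)%N) !divnK; first by rewrite (exprS _ (9 * _)); ring.
  by rewrite -(@Gauss_dvdl _ _ 2) // c2 dvdn_mulr //; lia.
by rewrite -(@Gauss_dvdl _ _ 2) // c0 dvdn_mull // dvdn_mulr.
Qed.

Lemma thetaE K : (0 < K)%N ->
  theta R K = 2 * \sum_(0 <= k < K) (-1) ^+ k * 'X^(k * k) - 1.
Proof. by move=> K0; rewrite /theta (big_ltn K0) !expr0; ring. Qed.

(** Indices 3j give 9j^2 with sign (-1)^(3j) = (-1)^j; all other squares are 1 mod 3. *)
Lemma theta_dissect J : (0 < J)%N ->
  exists B : {poly R}, theta R (3 * J) = (theta R J \Po 'X^9) + (B \Po 'X^3) * 'X.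
Proof.
move=> J_gt0; rewrite !thetaE ?muln_gt0 //.
suff [B ->] : exists B : {poly R},
    \sum_(0 <= k < 3 * J) (-1) ^+ k * 'X^(k * k) =
    ((\sum_(0 <= k < J) (-1) ^+ k * 'X^(k * k)) \Po 'X^9) + (B \Po 'X^3) * 'X.
  exists (2 * B); rewrite !rmorphB !rmorphM /= rmorph_nat rmorph1.
  rewrite (rmorph_nat (comp_poly 'X^3)); ring.
elim: J {J_gt0} => [|J [B IHJ]].
  by exists 0; rewrite !big_geq // !comp_poly0 mul0r addr0.
exists (B + (-1) ^+ J.+1 * 'X^(3 * (J * J) + 2 * J)
  + (-1) ^+ J * 'X^(3 * (J * J) + 4 * J + 1)).
rewrite mulnS add3n !big_nat_recr //= IHJ.
rewrite !comp_polyD !comp_polyM !rmorphXn !rmorphN1 /= !comp_polyX -!exprM.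
have sg3 : (-1) ^+ (3 * J) = (-1) ^+ J :> {poly R}.
  by rewrite exprM; congr (_ ^+ J); ring.
rewrite ![(-1) ^+ _.+1]exprS sg3.
rewrite (_ : (3 * J).+1 * (3 * J).+1 = (3 * (3 * (J * J) + 2 * J)).+1)%N; last by nia.
rewrite (_ : (3 * J).+2 * (3 * J).+2 = (3 * (3 * (J * J) + 4 * J + 1)).+1)%N; last by nia.
rewrite (_ : 3 * J * (3 * J) = 9 * (J * J))%N; last by nia.
by rewrite !exprS; ring.
Qed.

Variables (N : nat).
(** Each dissection divides a truncation by 3: from [K] to [J] in the theta series, and from [J] to
    [N] in the precision after [trisect]. *)
Let J := (3 * N)%N.
Let K := (3 * J)%N.
Notation E := (@euler R K).
Notation Ps k := (psi R K \Po 'X^k).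
Notation Th k := (theta R K \Po 'X^k).
Hypothesis N_gt0 : (0 < N)%N.

Let J_gt0 : (0 < J)%N. Proof. by rewrite muln_gt0. Qed.
Let leJK : (J <= K)%N. Proof. by rewrite leq_pmull. Qed.

Lemma theta_euler k : (0 < k)%N -> eqX J (Th k * E (2 * k)) (E k ^+ 2).
Proof.
move=> k_gt0; have := eqX_comp k_gt0 (@gauss_square R J K leJK).
by rewrite rmorphM rmorphXn /= !euler_comp mul1n.
Qed.

Lemma psi_euler k : (0 < k)%N -> eqX J (Ps k * E k) (E (2 * k) ^+ 2).
Proof.
move=> k_gt0; have := eqX_comp k_gt0 (@gauss_triangle R J K J_gt0 leJK).
by rewrite rmorphM rmorphXn /= !euler_comp mul1n.
Qed.

Lemma psi_stableJ k : (0 < k)%N -> eqX N (psi R J \Po 'X^k) (Ps k).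
Proof.
move=> k_gt0; apply: eqX_sym; apply: (@eqX_leq _ N J); first by rewrite leq_pmull.
by apply: eqX_comp => //; apply: psi_stable.
Qed.

Lemma theta_stableJ k : (0 < k)%N -> eqX N (theta R J \Po 'X^k) (Th k).
Proof.
move=> k_gt0; apply: eqX_sym; apply: (@eqX_leq _ N J); first by rewrite leq_pmull.
by apply: eqX_comp => //; apply: theta_stable.
Qed.

Variable G : {poly R}.
Hypothesis G_euler : eqX J (G * (E 1 * E 36)) (E 9 * E 4).

Lemma trisect_mod4 : 4 = 0 :> R -> eqX N (trisect G) 1.
Proof.
move=> R4; have P4 : 4 = 0 :> {poly R} by exact: poly_natr_eq0.
(* Factor by factor, (1 - x)^4 = (1 - x^2)^2 modulo 4. *)
have E24 k : E (2 * k) ^+ 4 = E (4 * k) ^+ 2.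
  rewrite -!prodrXl; apply: eq_bigr => m _.
  rewrite (_ : 4 * k * m = 2 * k * m * 2)%N ?(exprM _ _ 2); last by lia.
  set x := 'X^_.
  transitivity ((1 - x ^+ 2) ^+ 2 - 4 * (x * (1 - x) ^+ 2)); first by ring.
  by rewrite P4 mul0r subr0.
(* Both of Gauss's identities evaluate f_(2k)^2, as psi(q^k) f_k and as phi(-q^(2k)) f_(4k). Their
   product is f_(2k)^4 = f_(4k)^2, and one f_(4k) cancels. *)
have E4 k : (0 < k)%N -> eqX J (E (4 * k)) (E k * (Ps k * Th (2 * k))).
  move=> k_gt0; have k4 : (0 < 4 * k)%N by rewrite muln_gt0.
  apply: (eqX_cancel (coef0_euler R K k4)).
  rewrite -expr2 -E24 (exprM _ 2 2) expr2 -{1}(psi_euler k_gt0).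
  rewrite -(@theta_euler (2 * k)) ?muln_gt0 // mulnA.
  by rewrite (_ : E (4 * k) * _ = Ps k * E k * (Th (2 * k) * E (4 * k))) //; ring.
have GPs : eqX J (G * (Ps 9 * Th 18)) (Ps 1 * Th 2).
  apply: (@eqX_cancel _ _ (E 1 * E 9)).
    by rewrite coef0M !coef0_euler ?mulr1.
  have E36 : eqX J (E 36) (E 9 * (Ps 9 * Th 18)) by exact: (E4 9%N).
  have := G_euler; rewrite E36 (E4 1%N isT : eqX J (E 4) _) => GE.
  rewrite (_ : _ * _ * (G * _) = G * (E 1 * (E 9 * (Ps 9 * Th 18)))); last by ring.
  by rewrite GE (_ : E 9 * _ = E 1 * E 9 * (Ps 1 * Th 2)) //; ring.
have := eqX_trisect (GPs : eqX (3 * N) _ _).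
have [A PsE] := psi_dissect J; have [B ThE] := theta_dissect J_gt0.
rewrite -(comp_XnXn _ 3 3) -(comp_XnXn _ 6 3) -rmorphM [G * _]mulrC trisectM.
(* Expansion of (A(q^3) + q psi(q^9)) (phi(-q^18) + q^2 B(q^6)), grouped by exponents 0, 1, 2 mod
   3. *)
have -> : Ps 1 * Th 2 = (((A * (theta R J \Po 'X^6) +
    (psi R J \Po 'X^3) * (B \Po 'X^2) * 'X) \Po 'X^3) +
    ((psi R J \Po 'X^3) * (theta R J \Po 'X^6) \Po 'X^3) * 'X) +
    (A * (B \Po 'X^2) \Po 'X^3) * 'X^2.
  rewrite comp_polyXr PsE ThE !(rmorphD, rmorphM) /= !comp_XnXn !comp_polyX; ring.
rewrite !trisectD trisect_comp trisectX trisectX2 add0r addr0.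
rewrite psi_stableJ // theta_stableJ // -[X in eqX _ _ X]mulr1.
apply: eqX_cancel.
by rewrite coef0M !coef0_comp_Xn // coef0_psi ?coef0_theta ?mulr1 // muln_gt0.
Qed.

(** * Characteristic 3, where cubing is the substitution of q^3 for q in these series *)

Section Mod3.
Hypothesis R3 : 3 = 0 :> R.

Let P3 : 3 = 0 :> {poly R}. Proof. exact: poly_natr_eq0. Qed.

Lemma cubeD (x y : {poly R}) : (x + y) ^+ 3 = x ^+ 3 + y ^+ 3.
Proof.
transitivity (x ^+ 3 + y ^+ 3 + 3 * (x * y * (x + y))); first by ring.
by rewrite P3 mul0r addr0.
Qed.

Lemma cube_sum (r : seq nat) (F : nat -> {poly R}) :
  (\sum_(k <- r) F k) ^+ 3 = \sum_(k <- r) F k ^+ 3.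
Proof. by elim/big_rec2: _ => [|k x y _ <-]; rewrite ?cubeD // expr0n. Qed.

Lemma euler_cube k : E k ^+ 3 = E (3 * k).
Proof.
rewrite -prodrXl; apply: eq_bigr => m _.
by rewrite cubeD -mulnA (mulnC 3%N) (exprM _ _ 3); ring.
Qed.

Lemma psi_cube : psi R K ^+ 3 = Ps 3.
Proof.
rewrite /psi cube_sum rmorph_sum; apply: eq_bigr => k _ /=.
by rewrite comp_Xn_poly -!exprM mulnC.
Qed.

Lemma theta_cube : theta R K ^+ 3 = Th 3.
Proof.
rewrite /theta cubeD exprMn cube_sum rmorphD rmorphM rmorph_sum rmorph1 /=.
rewrite (rmorph_nat (comp_poly 'X^3)) expr1n.
have -> : (2 : {poly R}) ^+ 3 = 2 
  by transitivity (2 + 3 * 2 : {poly R}); [ring | rewrite P3 mul0r addr0].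
congr (_ + _ * _); apply: eq_bigr => k _.
rewrite exprMn rmorphM rmorphXn rmorphN1 /= comp_Xn_poly.
by rewrite -signr_odd; case: odd; rewrite -!exprM (mulnC 3%N); ring.
Qed.

Lemma trisect_mod3 : eqX N (trisect G) (1 + 'X * (Ps 2 * Ps 6)).
Proof.
have E0 k : (0 < k)%N -> (E k)`_0 = 1 by apply: coef0_euler.
have Ps0 k : (0 < k)%N -> (Ps k)`_0 = 1.
  by move=> k0; rewrite coef0_comp_Xn // coef0_psi // muln_gt0.
pose s := Ps 2 * Ps 6.
have Ps6 : Ps 2 ^+ 3 = Ps 6.
  by rewrite -rmorphXn /= psi_cube comp_XnXn.
(* Here s = psi(q^2)^4 and phi(-q) phi(-q^3) = phi(-q)^4. Multiplying by f_2^4 turns the claim into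
   G f_4^8 = f_1^8; after a further factor f_1 f_4, ninth powers give f_36 and f_9. *)
have Gs : eqX J (G * s) (1 + 'X * s).
  rewrite -(@theta_theta3 R R3 J K) ?leq_mul // -theta_cube -exprS /s -Ps6 -exprS.
  apply: (@eqX_cancel _ _ (E 2 ^+ 4)); first by rewrite coef0_exp // E0.
  rewrite -exprMn [E 2 * _]mulrC.
  have -> : E 2 ^+ 4 * (G * Ps 2 ^+ 4) = G * (Ps 2 * E 2) ^+ 4 by ring.
  have := @theta_euler 1 isT; rewrite comp_polyXr => ->.
  rewrite (@psi_euler 2) // -!exprM.
  apply: (@eqX_cancel _ _ (E 1 * E 4)); first by rewrite coef0M !E0 ?mulr1.
  have := G_euler.
  rewrite -(euler_cube 12) -(euler_cube 4) -(euler_cube 3) -(euler_cube 1) => GE.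
  have -> : E 1 * E 4 * (G * E (2 * 2) ^+ (2 * 4)) = G * (E 1 * ((E 4 ^+ 3) ^+ 3)) by ring.
  by rewrite GE (_ : E 1 ^+ 3 ^+ 3 * E 4 = E 1 * E 4 * E 1 ^+ (2 * 4)) //; ring.
have s3 : s ^+ 3 = s \Po 'X^3.
  by rewrite exprMn -!rmorphXn /= psi_cube /s rmorphM /= !comp_XnXn.
(* The identity for G s is multiplied by s^2, so that G and the factor psi(q^6)^2 of s^2 stand
   beside series in q^3. *)
have GsE : eqX (3 * N) ((s \Po 'X^3) * G)
    ((Ps 2 ^+ 2 \Po 'X^3) * Ps 2 ^+ 2 + (s \Po 'X^3) * 'X).
  have -> : (s \Po 'X^3) * G = G * s * s ^+ 2 by rewrite -s3; ring.
  rewrite Gs -s3 rmorphXn /= comp_XnXn.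
  have -> // : (1 + 'X * s) * s ^+ 2 = Ps 6 ^+ 2 * Ps 2 ^+ 2 + s ^+ 3 * 'X.
  by rewrite /s; ring.
have := eqX_trisect GsE; rewrite trisectD trisectX !trisectM.
have [A PsE] := psi_dissect J.
(* In the square of A(q^6) + q^2 psi(q^18), only q^4 psi(q^18)^2 has exponents 1 mod 3. *)
have -> : trisect (Ps 2 ^+ 2) = 'X * (psi R J \Po 'X^6) ^+ 2.
  have -> : Ps 2 ^+ 2 = ((A ^+ 2 \Po 'X^2) \Po 'X^3) +
      ('X * (psi R J \Po 'X^6) ^+ 2 \Po 'X^3) * 'X +
      ((A \Po 'X^2) * (psi R J \Po 'X^6) +
        (A \Po 'X^2) * (psi R J \Po 'X^6) \Po 'X^3) * 'X^2.
    rewrite PsE !(rmorphD, rmorphM, rmorphXn) /= !comp_XnXn !comp_polyX; ring.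
  by rewrite !trisectD trisect_comp trisectX trisectX2 add0r addr0.
rewrite psi_stableJ // => gs.
apply: (@eqX_cancel _ _ s); first by rewrite coef0M !Ps0 ?mulr1.
rewrite gs.
by have -> : Ps 2 ^+ 2 * ('X * Ps 6 ^+ 2) + s = s * (1 + 'X * s) by rewrite /s; ring.
Qed.
End Mod3.
End Dissection.

(** * The generating function of RD *)

(** A partition is encoded by the multiplicity of each part size. Size 0 is divisible by [l], so its
    multiplicity is forced to be 0. *)
Definition multiplicities (l t K : nat) : pred {ffun 'I_K -> 'I_t} :=
  family (fun m : 'I_K => [pred j : 'I_t | (l %| m)%N ==> (j == 0 :> nat)]).
Arguments multiplicities : clear implicits.

Lemma sumn_count K (s : seq nat) : all (fun k => (k < K)%N) s ->
  sumn s = (\sum_(m < K) count_mem (m : nat) s * m)%N.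
Proof.
elim: s => [|x s IHs] /=; first by rewrite big1.
move=> /andP[xK /IHs->]; rewrite [RHS](eq_bigr _ (fun m _ => mulnDl _ _ _)).
rewrite big_split /=; congr (_ + _)%N; rewrite (bigD1 (Ordinal xK)) //= eqxx mul1n.
rewrite big1 ?addn0 // => m.
by rewrite -val_eqE eq_sym /= => /negPf->.
Qed.

Lemma part_leq n s k : is_partition n s -> k \in s -> (k <= n)%N.
Proof.
by case/and3P=> _ _ /eqP<- ks; rewrite (perm_sumn (perm_to_rem ks)) leq_addr.
Qed.

Lemma RD_multiplicities l t n K : (n < K)%N ->
  RD l t.+1 n =
  #|[set f : {ffun 'I_K -> 'I_t.+1} | (f \in multiplicities l t.+1 K) &&
    (\sum_(m < K) f m * m == n)%N]|.
Proof.
move=> nK; rewrite /RD; set A := [set b | _].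
pose parts (b : n.-bseq 'I_n.+1) := [seq val k | k <- b].
pose h b := [ffun m : 'I_K => inord (count_mem (m : nat) (parts b)) : 'I_t.+1].
have AP b : reflect [/\ is_partition n (parts b), regular l (parts b) &
    distinct t.+1 (parts b)] (b \in A) by rewrite inE; apply: and3P.
have count_lt b k : b \in A -> (count_mem k (parts b) < t.+1)%N.
  case/AP=> _ _ /allP dist; case: (boolP (k \in parts b)) => [/dist //|kb].
  by rewrite (count_memPn kb).
have hE b (m : 'I_K) : b \in A -> h b m = count_mem (m : nat) (parts b) :> nat.
  by move=> bA; rewrite ffunE inordK // count_lt.
rewrite -(@card_in_imset _ _ h A).
  apply: eq_card => f; rewrite !inE; apply/imsetP/andP.
    case=> b bA ->; have [part_b /allP reg_b _] := AP b bA; split.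
      apply/familyP => m; rewrite inE; apply/implyP => lm.
      rewrite hE // -leqn0 leqNgt -has_count has_pred1.
      by apply: contraL lm => /reg_b.
    have /and3P[_ _ /eqP sum_b] := part_b.
    apply/eqP; rewrite -[RHS]sum_b (@sumn_count K).
      by apply: eq_bigr => m _; rewrite hE.
    by apply/allP => k /(part_leq part_b) kn; apply: leq_ltn_trans nK.
  case=> /familyP fam_f /eqP sum_f.
  (* The inverse of [h]: each [m] is repeated [f m] times and the list is sorted. *)
  pose s := sort geq (flatten [seq nseq (f m) (m : nat) | m <- enum 'I_K]).
  have count_s k : count_mem k s = (\sum_(m < K) f m * (m == k :> nat))%N.
    rewrite (permP (permEl (perm_sort _ _))) count_flatten sumnE 2!big_map big_enum.
    by apply: eq_bigr => m _; rewrite /= count_nseq mulnC.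
  have count_ord (m : 'I_K) : count_mem (m : nat) s = f m.
    rewrite count_s (bigD1 m) //= eqxx muln1 big1 ?addn0 // => j.
    by rewrite -val_eqE => /negPf->; rewrite muln0.
  have mem_s k : k \in s -> exists2 m : 'I_K, k = m & (f m != 0 :> nat).
    rewrite -has_pred1 has_count => k_gt0.
    have kK : (k < K)%N.
      rewrite ltnNge; apply: contraL k_gt0 => Kk; rewrite count_s big1 // => m _.
      by rewrite ltn_eqF ?muln0 //; apply: leq_trans Kk.
    by exists (Ordinal kK) => //; rewrite -count_ord -lt0n.
  have f_reg (m : 'I_K) : (f m != 0 :> nat) -> ~~ (l %| m)%N.
    by have := fam_f m; rewrite inE => /implyP fm; apply: contra.
  have part_s : is_partition n s.
    apply/and3P; split.
    - by apply: sort_sorted => x y; apply: leq_total.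
    - apply/allP => k /mem_s[m -> /f_reg]; rewrite lt0n.
      by apply: contra => /eqP->; rewrite dvdn0.
    apply/eqP; rewrite -[RHS]sum_f (@sumn_count K).
      by apply: eq_bigr => m _; rewrite count_ord.
    by apply/allP => k /mem_s[m ->].
  have [b bE] := is_partition_bseq part_s.
  have bA : b \in A.
    apply/AP; rewrite /parts bE; split=> //.
      by apply/allP => k /mem_s[m -> /f_reg].
    by apply/allP => k /mem_s[m -> _]; rewrite count_ord.
  exists b => //; apply/ffunP => m; apply: val_inj => /=.
  by rewrite hE // /parts bE count_ord.
move=> b c bA cA hbc; apply: val_inj; apply: (inj_map val_inj).
have [/and3P[sorted_b _ _] _ _] := AP b bA.
have [/and3P[sorted_c _ _] _ _] := AP c cA.
(* Injectivity of [h]: a sorted list is determined by its multiplicities, which vanish from [K]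
   on. *)
apply: (@sorted_eq _ geq) => //.
- by move=> x y z xy yz; apply: leq_trans yz xy.
- by move=> x y; rewrite andbC => /anti_leq.
apply/allP => k _; apply/eqP => /=; have [kK|Kk] := ltnP k K.
  by rewrite -(hE b (Ordinal kK)) // -(hE c (Ordinal kK)) // hbc.
have count0 d : d \in A -> count_mem k (parts d) = 0%N.
  case/AP=> part_d _ _; apply/count_memPn; apply: contraL Kk => /(part_leq part_d).
  by rewrite -ltnNge => kn; apply: leq_ltn_trans nK.
by rewrite -/(parts b) -/(parts c) !count0.
Qed.

Section GeneratingFunction.
Variables (R : comNzRingType) (l t : nat).
Hypothesis l_gt0 : (0 < l)%N.

(* Since l divides 0, the factor at m = 0 is 1. *)
Definition gfRD K : {poly R} :=
  \prod_(m < K) \sum_(j < t.+1 | (l %| m)%N ==> (j == 0 :> nat)) 'X^(j * m).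

Lemma coef_gfRD K n : (n < K)%N -> (gfRD K)`_n = (RD l t.+1 n)%:R.
Proof.
move=> nK; rewrite (RD_multiplicities l t nK) /gfRD.
rewrite (bigA_distr_big_dep _ (fun (m : 'I_K) (j : 'I_t.+1) => 'X^(j * m))) coef_sum.
rewrite -sum1_card natr_sum [RHS]big_mkcond [LHS]big_mkcond.
apply: eq_bigr => f _ /=; rewrite !inE -/(multiplicities l t.+1 K) /=.
rewrite prodrXr coefXn eq_sym.
by case: ifP => //= _; case: ifP.
Qed.

(** Reindexing by multiples of [l] extends the product up to [l * K]; the extra factors are 1 modulo
    X^N. *)
Lemma euler_dvd N K c : (0 < c)%N -> (0 < N)%N -> (N <= K)%N ->
  eqX N (euler R K (c * l)) (\prod_(1 <= m < K | (l %| m)%N) (1 - 'X^(c * m))).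
Proof.
move=> c_gt0 N_gt0 NK.
have -> : euler R K (c * l) = \prod_(1 <= m < l * K | (l %| m)%N) (1 - 'X^(c * m)).
  rewrite -[RHS]big_filter /euler (eq_bigr (fun m => 1 - 'X^(c * (l * m)))); last first.
    by move=> m _; rewrite mulnA.
  rewrite -(big_map (muln l) xpredT (fun m => 1 - 'X^(c * m) : {poly R})).
  apply/perm_big/uniq_perm; rewrite ?filter_uniq ?map_inj_uniq ?iota_uniq //.
    by move=> x y /eqP; rewrite eqn_pmul2l // => /eqP.
  move=> m; rewrite mem_filter mem_index_iota; apply/mapP/idP => [[k]|].
    by rewrite mem_index_iota => kK ->; rewrite dvdn_mulr //= ltn_pmul2l // muln_gt0 l_gt0.
  case/and3P=> /dvdnP[k ->] kl_gt0; rewrite mulnC ltn_pmul2l // => kK.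
  by exists k; rewrite // mem_index_iota kK andbT; case: k kl_gt0 {kK}.
have KlK : (K <= l * K)%N by rewrite leq_pmull.
rewrite [X in eqX _ X _]big_mkcond [X in eqX _ _ X]big_mkcond.
rewrite (@big_cat_nat _ _ _ K) //=; last by apply: leq_trans NK.
rewrite [X in eqX _ (_ * X) _](_ : eqX N _ 1) ?mulr1 //.
apply: eqX_prod_geq NK KlK => m Nm; case: ifP => // _.
by apply: eqX_1subXn; apply: leq_trans Nm (leq_pmull _ _).
Qed.

(** For [m] prime to divisibility by [l], a finite geometric sum times 1 - X^m is 1 - X^((t+1)m).
    Multiplication by f_((t+1)l) supplies the missing factors of f_(t+1), and the leftover multiples
    of [l] in f_1 form f_l. *)
Lemma gfRD_euler N K : (0 < N)%N -> (N <= K)%N ->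
  eqX N (gfRD K * (euler R K 1 * euler R K (t.+1 * l)))
    (euler R K t.+1 * euler R K l).
Proof.
move=> N_gt0 NK; have K_gt0 : (0 < K)%N by apply: leq_trans NK.
have gfE : gfRD K * euler R K 1 =
    (\prod_(1 <= m < K | ~~ (l %| m)%N) (1 - 'X^(t.+1 * m))) *
    (\prod_(1 <= m < K | (l %| m)%N) (1 - 'X^(1 * m))).
  rewrite /gfRD -(big_mkord xpredT (fun m : nat =>
    \sum_(j < t.+1 | (l %| m)%N ==> (j == 0 :> nat)) 'X^(j * m) : {poly R})).
  rewrite (big_ltn K_gt0) dvdn0 /= (bigD1 ord0) //= big1 => [|j /andP[/eqP j0]].
    rewrite addr0 mul1r [in RHS]big_mkcond [X in _ = _ * X]big_mkcond -!big_split.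
    apply: eq_big_nat => m _ /=; case: (l %| m)%N => /=.
      rewrite (bigD1 ord0) //= big1 ?addr0 => [|j /andP[/eqP j0]]; first by rewrite expr0.
      by rewrite -val_eqE /= j0.
    rewrite mulr1 mul1n; apply: (@addrI _ (-1)).
    rewrite mulnC exprM.
    have -> : \sum_(j < t.+1) 'X^(j * m) = \sum_(j < t.+1) 'X^m ^+ j :> {poly R}.
      by apply: eq_bigr => j _; rewrite mulnC exprM.
    by have /eqP := subrX1 ('X^m : {poly R}) t.+1; rewrite subr_eq => /eqP->; ring.
  by rewrite -val_eqE /= j0.
have e1 := @euler_dvd N K 1 isT N_gt0 NK.
have el := @euler_dvd N K t.+1 isT N_gt0 NK; rewrite mul1n in e1.
rewrite mulrA gfE el e1.
rewrite [euler R K t.+1](bigID (fun m => l %| m)%N) /=.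
set a := \prod_(_ <= _ < _ | _) _; set b := \prod_(_ <= _ < _ | _) _.
set c := \prod_(_ <= _ < _ | _) _.
by have -> : a * b * c = c * a * b by ring.
Qed.
End GeneratingFunction.

(** * Residues modulo 4 and 3 *)

(** Otherwise z = x/y is a square root of -3 mod p and w = (z - 1)/2 satisfies w^3 = 1. As p = 2 mod
    3, Fermat gives w = w^p = w^2, so w = 1, z = 3 and 12 = 0 mod p. *)
Lemma dvdn_sqr3_sqr p x y : prime p -> p = 5 %[mod 6] ->
  (p %| x * x + 3 * (y * y) -> (p %| x) && (p %| y))%N.
Proof.
move=> p_pr p5 p_xy.
have p_gt1 := prime_gt1 p_pr.
have p12 : ~~ (p %| 12)%N.
  apply/negP => p12; have p_le := dvdn_leq (isT : (0 < 12)%N) p12.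
  have [pE|pE] : p = 5%N \/ p = 11%N by lia.
    by rewrite pE in p12.
  by rewrite pE in p12.
have FpE k : (p %| k)%N = (k%:R == 0 :> 'F_p) by rewrite (dvdn_pcharf (pchar_Fp p_pr)).
case: (boolP (p %| y)%N) => p_y.
  move: p_xy; rewrite dvdn_addl; last by rewrite !dvdn_mull.
  by rewrite Euclid_dvdM // orbb => ->.
exfalso; move: p_xy p_y; rewrite !FpE natrD !natrM => /eqP xy0 y0.
pose z : 'F_p := x%:R / y%:R; pose w := (z - 1) / 2.
have z2 : z ^+ 2 = - 3.
  have zy : z * y%:R = x%:R by rewrite divfK.
  apply: (mulIf (mulf_neq0 y0 y0)); apply/eqP.
  by rewrite -subr_eq0 -xy0 -zy; apply/eqP; ring.
have two0 : 2 != 0 :> 'F_p.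
  by rewrite -(FpE 2%N); apply: contra p12 => p2; apply: dvdn_trans p2 _.
have w3 : w ^+ 3 = 1.
  rewrite /w expr_div_n; apply: (mulIf (expf_neq0 3 two0)); rewrite divfK ?expf_neq0 //.
  transitivity (z ^+ 2 * z - 3 * z ^+ 2 + 3 * z - 1); first by ring.
  by rewrite z2; ring.
have w0 : w != 0 by apply: contra_eq_neq w3 => ->; rewrite expr0n eq_sym oner_eq0.
have w1 : w = 1.
  have wp : w ^+ p = w by have := expf_card w; rewrite card_Fp.
  have pE : (3 * (p %/ 3) + 2 = p)%N by lia.
  have wp' : w ^+ (3 * (p %/ 3) + 2) = w by rewrite pE.
  have ww : w * w = w by rewrite -[RHS]wp' exprD exprM w3 expr1n mul1r.
  by apply: (mulIf w0); rewrite mul1r.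
have z3 : z = 3.
  have -> : z = w * 2 + 1 by rewrite /w divfK //; ring.
  by rewrite w1; ring.
move: p12; rewrite FpE; apply/negP; rewrite negbK; apply/eqP.
transitivity (z ^+ 2 + 3); first by rewrite z3; ring.
by rewrite z2; ring.
Qed.

(** Descent: x and y are both divisible by p, and dividing them lowers the exponent by 2. At
    exponent 1 it would make p divide c. *)
Lemma sqr3_sqr_neq p x y c alpha : prime p -> p = 5 %[mod 6] -> ~~ (p %| c)%N ->
  (x * x + 3 * (y * y) != c * p ^ (2 * alpha + 1))%N.
Proof.
move=> p_pr p5 pc; have p_gt0 := prime_gt0 p_pr.
elim: alpha x y => [|alpha IHa] x y; apply/eqP => xyE.
all: have /andP[/dvdnP[x' xE] /dvdnP[y' yE]] : ((p %| x) && (p %| y))%N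
  by apply: dvdn_sqr3_sqr; rewrite // xyE addn1 expnS mulnCA dvdn_mulr.
all: have xyE' : (p * (p * (x' * x' + 3 * (y' * y'))) = x * x + 3 * (y * y))%N
  by rewrite xE yE; ring.
  case/negP: pc; apply/dvdnP; exists (x' * x' + 3 * (y' * y'))%N.
  by apply/eqP; rewrite eq_sym -(eqn_pmul2l p_gt0) (mulnC _ p) xyE' xyE mulnC.
have /eqP[] := IHa x' y'; apply/eqP.
rewrite -(eqn_pmul2l p_gt0) -(eqn_pmul2l p_gt0) xyE' xyE; apply/eqP.
by rewrite mulnS -addnA expnD; ring.
Qed.

(** A term of exponent m = 1 + a(a+1) + 3b(b+1) amounts to (2a+1)^2 + 3(2b+1)^2 = 4m. *)
Lemma coef_psi2_psi6 (R : comNzRingType) K m :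
    (forall x y, (x * x + 3 * (y * y) != 4 * m)%N) -> (0 < m)%N ->
  (1 + 'X * ((psi R K \Po 'X^2) * (psi R K \Po 'X^6)))`_m = 0.
Proof.
case: m => // m xyN _; rewrite coefD coef1 coefXM add0r /=.
rewrite !rmorph_sum big_distrlr coef_sum big1 // => a _.
rewrite coef_sum big1 // => b _ /=.
rewrite !comp_Xn_poly -!exprM -exprD coefXn; case: eqP => // abm.
have := xyN a.*2.+1 b.*2.+1; have := bin2S_double a; have := bin2S_double b.
by move=> hb ha /eqP[]; nia.
Qed.

Section RD49.
Variables (R : comNzRingType) (m : nat).
Hypothesis m_gt0 : (0 < m)%N.
(** The truncation of the dissection for [N = m.+1], the least precision that includes index [m]. *)
Let K := (3 * (3 * m.+1))%N.
Let gf_euler : eqX (3 * m.+1) (gfRD R 4 8 K * (euler R K 1 * euler R K 36))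
  (euler R K 9 * euler R K 4).
Proof. by apply: (@gfRD_euler R 4 8 isT); rewrite ?leq_pmull. Qed.

Let coef_RD : (RD 4 9 (3 * m + 1))%:R = (trisect (gfRD R 4 8 K))`_m.
Proof. by rewrite coef_trisect coef_gfRD // /K; lia. Qed.

Lemma RD49_mod4 : 4 = 0 :> R -> (RD 4 9 (3 * m + 1))%:R = 0 :> R.
Proof.
move=> R4; rewrite coef_RD (@trisect_mod4 _ m.+1 isT _ gf_euler R4) //.
by rewrite coef1 gtn_eqF.
Qed.

Lemma RD49_mod3 : 3 = 0 :> R -> (forall x y, (x * x + 3 * (y * y) != 4 * m)%N) ->
  (RD 4 9 (3 * m + 1))%:R = 0 :> R.
Proof.
move=> R3 xyN; rewrite coef_RD.
by rewrite (@trisect_mod3 _ m.+1 isT _ gf_euler R3) // coef_psi2_psi6.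
Qed.
End RD49.

Lemma Zp_natr_eq0 q k : (1 < q)%N -> k%:R = 0 :> 'Z_q -> (q %| k)%N.
Proof. by move=> q_gt1 /(congr1 val); rewrite /= val_Zp_nat // => /eqP. Qed.

Local Close Scope ring_scope.

Theorem theorem5p1 (p : nat) (p_prime : prime p) (p_mod6 : p = 5 %[mod 6])
    (alpha n i : nat) (i_bounds : 1 <= i <= p - 1) :
  RD 4 9 (6 * p ^ (2 * alpha + 1) * (p * n + i) + 3 * p ^ (2 * alpha + 2) + 1)
    = 0 %[mod 12].
Proof.
set c := (2 * (p * n + i) + p)%N.
have -> : (6 * p ^ (2 * alpha + 1) * (p * n + i) + 3 * p ^ (2 * alpha + 2) =
    3 * (p ^ (2 * alpha + 1) * c))%N.
  by rewrite /c (addnS _ 1) expnS; ring.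
set m := (p ^ _ * c)%N.
have m_gt0 : (0 < m)%N by rewrite muln_gt0 expn_gt0 prime_gt0 // /c; lia.
(* Modulo p, c is 2i with 0 < i < p, and p is odd. *)
have p_c : ~~ (p %| 4 * c)%N.
  have p_odd : (p %% 2 = 1)%N by lia.
  have p_ndvd k : (0 < k < p)%N -> ~~ (p %| k)%N by case/andP=> k0 kp; rewrite gtnNdvd.
  have p_gt4 : (4 < p)%N by lia.
  rewrite !Euclid_dvdM // /c dvdn_addl // negb_or p_ndvd //=.
  rewrite Euclid_dvdM // negb_or p_ndvd 1?(ltn_trans _ p_gt4) //.
  by rewrite dvdn_addr ?dvdn_mulr // p_ndvd //; lia.
have xyN x y : (x * x + 3 * (y * y) != 4 * m)%N.
  have -> : (4 * m = 4 * c * p ^ (2 * alpha + 1))%N by rewrite /m mulnCA mulnC.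
  exact: sqr3_sqr_neq.
apply/eqP; rewrite mod0n -[_ == _]/(12 %| _)%N (@Gauss_dvd 4 3) //.
apply/andP; split; apply: Zp_natr_eq0 => //.
  by apply: RD49_mod4; last exact: val_inj.
by apply: RD49_mod3 => //; apply: val_inj.
Qed.
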